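(* Let $(M;\oplus,^-,^\sim,0,1)$ be a pseudo MV-algebra with $0\neq 1$ and let $r:M\to M$ be a square root on $M$. Then $M$ satisfies exactly one of the following statements: (i) $M$ is a Boolean algebra. (ii) $M$ is a strict pseudo MV-algebra. (iii) $M$ is isomorphic to a direct product $M_1\times M_2$, where $M_1$ is a Boolean algebra and $M_2$ is a strict pseudo MV-algebra (both non-degenerate). Moreover, in case (iii), the Boolean algebra $M_1$ and the strict pseudo MV-algebra $M_2$ are uniquely determined by $M$ up to isomorphism.
   Context: A pseudo MV-algebra is an algebra $(M;\oplus,^-,^\sim,0,1)$ of type $(2,1,1,0,0)$ such that, writing $x\odot y:=(y^-\oplus x^-)^\sim$, for all $x,y,z\in M$: (A1) $x\oplus(y\oplus z)=(x\oplus y)\oplus z$; (A2) $x\oplus 0=0\oplus x=x$; (A3) $x\oplus 1=1\oplus x=1$; (A4) $1^-=1^\sim=0$; (A5) $(x^-\oplus y^-)^\sim=(x^\sim\oplus y^\sim)^-$; (A6) $x\oplus(x^\sim\odot y)=y\oplus(y^\sim\odot x)=(x\odot y^-)\oplus y=(y\odot x^-)\oplus x$; (A7) $x\odot(x^-\oplus y)=(x\oplus y^\sim)\odot y$; (A8) $(x^-)^\sim=x$. It is a bounded distributive lattice whose join $x\vee y$ is the common value in (A6) and whose meet $x\wedge y$ is the common value in (A7); $\le$ is the lattice order. Put $x\to y:=x^-\oplus y$ and $x\rightsquigarrow y:=y\oplus x^\sim$. It is degenerate if $0=1$. A map $r:M\to M$ is a square root on $M$ if (Sq1) $r(x)\odot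 r(x)=x$ for all $x\in M$; (Sq2) for all $x,y\in M$, $y\odot y\le x$ implies $y\le r(x)$; (Sq3) for all $x\in M$, $r(x^-)=r(x)\to r(0)$ and $r(x^\sim)=r(x)\rightsquigarrow r(0)$. A square root on $M$ is unique if it exists. A square root $r$ is strict if $r(0)=r(0)^-$; a pseudo MV-algebra is called strict if it has a strict square root. An element $x$ is Boolean if $x\oplus x=x$; $M$ is a Boolean algebra if all its elements are Boolean. *)

(* Defs.v *)
From HB Require Import structures.
From mathcomp Require Import all_boot.

Set Implicit Arguments.
Unset Strict Implicit.
Unset Printing Implicit Defensive.

Declare Scope pmv_scope.
Delimit Scope pmv_scope with pmv.

(* The product x ⊙ y = (y^- ⊕ x^-)^~ for bare operations; the mixin below
   needs it before the structure exists. *)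
Definition pmv_odot (T : Type) (oplus : T -> T -> T) (lneg rneg : T -> T)
  (x y : T) : T := rneg (oplus (lneg y) (lneg x)).

(* lneg x is x^- and rneg x is x^~. The carrier is an arbitrary Type: neither
   decidable equality nor a choice operator is assumed. *)
HB.mixin Record isPseudoMV (T : Type) := {
  oplus : T -> T -> T;
  lneg : T -> T;
  rneg : T -> T;
  pmv0 : T;
  pmv1 : T;
  oplusA : forall x y z, oplus x (oplus y z) = oplus (oplus x y) z;
  oplusx0 : forall x, oplus x pmv0 = x;
  oplus0x : forall x, oplus pmv0 x = x;
  oplusx1 : forall x, oplus x pmv1 = pmv1;
  oplus1x : forall x, oplus pmv1 x = pmv1;
  lneg1 : lneg pmv1 = pmv0;
  rneg1 : rneg pmv1 = pmv0;
  neg_oplus : forall x y,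
    rneg (oplus (lneg x) (lneg y)) = lneg (oplus (rneg x) (rneg y));
  oplus_rneg_odotC : forall x y,
    oplus x (pmv_odot oplus lneg rneg (rneg x) y)
    = oplus y (pmv_odot oplus lneg rneg (rneg y) x);
  oplus_rneg_odot_lneg : forall x y,
    oplus y (pmv_odot oplus lneg rneg (rneg y) x)
    = oplus (pmv_odot oplus lneg rneg x (lneg y)) y;
  odot_lneg_oplusC : forall x y,
    oplus (pmv_odot oplus lneg rneg x (lneg y)) y
    = oplus (pmv_odot oplus lneg rneg y (lneg x)) x;
  odot_lneg_oplus : forall x y,
    pmv_odot oplus lneg rneg x (oplus (lneg x) y)
    = pmv_odot oplus lneg rneg (oplus x (rneg y)) y;
  lnegK : forall x, rneg (lneg x) = x
}.

#[short(type="pseudoMVType")]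
HB.structure Definition PseudoMV := {T of isPseudoMV T}.

Arguments pmv0 {s}.
Arguments pmv1 {s}.

Definition odot (M : pseudoMVType) (x y : M) : M :=
  pmv_odot (@oplus M) (@lneg M) (@rneg M) x y.

Notation "x ⊕ y" := (oplus x y)
  (at level 50, left associativity) : pmv_scope.
Notation "x ⊙ y" := (odot x y)
  (at level 40, left associativity) : pmv_scope.
Notation "0" := pmv0 : pmv_scope.
Notation "1" := pmv1 : pmv_scope.

Local Open Scope pmv_scope.

Definition pmv_join (M : pseudoMVType) (x y : M) : M := x ⊕ (rneg x ⊙ y).

Definition pmv_le (M : pseudoMVType) (x y : M) : Prop := pmv_join x y = y.

Notation "x ≤ y" := (pmv_le x y) (at level 70, no associativity) : pmv_scope.

(* limpl x y is x → y and rimpl x y is x ⇝ y. *)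
Definition limpl (M : pseudoMVType) (x y : M) : M := lneg x ⊕ y.
Definition rimpl (M : pseudoMVType) (x y : M) : M := y ⊕ rneg x.

Definition degenerate (M : pseudoMVType) : Prop := 0 = 1 :> M.

Record square_root (M : pseudoMVType) (r : M -> M) : Prop := SquareRoot {
  sqrt_odot : forall x, r x ⊙ r x = x;
  sqrt_max : forall x y, y ⊙ y ≤ x -> y ≤ r x;
  sqrt_lneg : forall x, r (lneg x) = limpl (r x) (r 0);
  sqrt_rneg : forall x, r (rneg x) = rimpl (r x) (r 0)
}.

Definition strict_square_root (M : pseudoMVType) (r : M -> M) : Prop :=
  square_root r /\ r 0 = lneg (r 0).

Definition strict_pmv (M : pseudoMVType) : Prop :=
  exists r : M -> M, strict_square_root r.

Definition boolean_elt (M : pseudoMVType) (x : M) : Prop := x ⊕ x = x.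

Definition boolean_algebra (M : pseudoMVType) : Prop :=
  forall x : M, boolean_elt x.

Record pmv_morphism (M N : pseudoMVType) (f : M -> N) : Prop := PmvMorphism {
  morph_oplus : forall x y, f (x ⊕ y) = f x ⊕ f y;
  morph_lneg : forall x, f (lneg x) = lneg (f x);
  morph_rneg : forall x, f (rneg x) = rneg (f x);
  morph_pmv0 : f 0 = 0;
  morph_pmv1 : f 1 = 1
}.

Definition pmv_isomorphic (M N : pseudoMVType) : Prop :=
  exists f : M -> N, pmv_morphism f /\ bijective f.

Section Product.
Variables M N : pseudoMVType.

Let poplus (u v : M * N) := (u.1 ⊕ v.1, u.2 ⊕ v.2).
Let plneg (u : M * N) := (lneg u.1, lneg u.2).
Let prneg (u : M * N) := (rneg u.1, rneg u.2).

Fact prod_oplusA x y z : poplus x (poplus y z) = poplus (poplus x y) z.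
Proof. by rewrite /poplus /= !oplusA. Qed.

Fact prod_oplusx0 x : poplus x (0, 0) = x.
Proof. by case: x => a b; rewrite /poplus /= !oplusx0. Qed.

Fact prod_oplus0x x : poplus (0, 0) x = x.
Proof. by case: x => a b; rewrite /poplus /= !oplus0x. Qed.

Fact prod_oplusx1 x : poplus x (1, 1) = (1, 1).
Proof. by rewrite /poplus /= !oplusx1. Qed.

Fact prod_oplus1x x : poplus (1, 1) x = (1, 1).
Proof. by rewrite /poplus /= !oplus1x. Qed.

Fact prod_lneg1 : plneg (1, 1) = (0, 0).
Proof. by rewrite /plneg /= !lneg1. Qed.

Fact prod_rneg1 : prneg (1, 1) = (0, 0).
Proof. by rewrite /prneg /= !rneg1. Qed.

Fact prod_neg_oplus x y :
  prneg (poplus (plneg x) (plneg y)) = plneg (poplus (prneg x) (prneg y)).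
Proof. by congr pair; apply: neg_oplus. Qed.

Fact prod_oplus_rneg_odotC x y :
  poplus x (pmv_odot poplus plneg prneg (prneg x) y)
  = poplus y (pmv_odot poplus plneg prneg (prneg y) x).
Proof. by congr pair; apply: oplus_rneg_odotC. Qed.

Fact prod_oplus_rneg_odot_lneg x y :
  poplus y (pmv_odot poplus plneg prneg (prneg y) x)
  = poplus (pmv_odot poplus plneg prneg x (plneg y)) y.
Proof. by congr pair; apply: oplus_rneg_odot_lneg. Qed.

Fact prod_odot_lneg_oplusC x y :
  poplus (pmv_odot poplus plneg prneg x (plneg y)) y
  = poplus (pmv_odot poplus plneg prneg y (plneg x)) x.
Proof. by congr pair; apply: odot_lneg_oplusC. Qed.

Fact prod_odot_lneg_oplus x y :
  pmv_odot poplus plneg prneg x (poplus (plneg x) y)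
  = pmv_odot poplus plneg prneg (poplus x (prneg y)) y.
Proof. by congr pair; apply: odot_lneg_oplus. Qed.

Fact prod_lnegK x : prneg (plneg x) = x.
Proof. by case: x => a b; rewrite /prneg /= !lnegK. Qed.

HB.instance Definition _ := isPseudoMV.Build (M * N)%type
  prod_oplusA prod_oplusx0 prod_oplus0x prod_oplusx1 prod_oplus1x
  prod_lneg1 prod_rneg1 prod_neg_oplus prod_oplus_rneg_odotC
  prod_oplus_rneg_odot_lneg prod_odot_lneg_oplusC prod_odot_lneg_oplus
  prod_lnegK.

End Product.

Definition boolean_strict_decomposition (M M1 M2 : pseudoMVType) : Prop :=
  [/\ boolean_algebra M1, strict_pmv M2, ~ degenerate M1, ~ degenerate M2
    & pmv_isomorphic M (M1 * M2)%type].

Definition exactly_one (P Q S : Prop) : Prop :=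
  (P \/ Q \/ S) /\ [/\ ~ (P /\ Q), ~ (P /\ S) & ~ (Q /\ S)].

(* Main.v *)
Require Import Defs.
From HB Require Import structures.
From mathcomp Require Import all_boot.
From Stdlib Require Import Classical ProofIrrelevance.

(** Put [c = r 0] and [w = c ⊕ c]. The square-root laws give [r w ≤ w], so
    [w = r w ⊙ r w ≤ w ⊙ w] and [w] is Boolean. Boolean elements are central,
    so [M] is the product of its quotients by the ideals generated by [w] and
    by its complement. The square root descends to both: in the first one [c]
    becomes 0, which makes all elements Boolean; in the second one [c ⊕ c]
    becomes 1, which makes the square root strict. Conversely [c] is the
    largest element with [c ⊙ c = 0], so every isomorphism of [M] with a
    product of a Boolean algebra and a strict algebra maps [w] to [(0, 1)]. *)

Set Implicit Arguments.
Unset Strict Implicit.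
Unset Printing Implicit Defensive.

Local Open Scope pmv_scope.

(** * Negations, order and lattice operations in a pseudo MV-algebra *)

Section Theory.
Variable M : pseudoMVType.
Implicit Types x y z t a : M.

Lemma rnegK x : lneg (rneg x) = x.
Proof. by have := neg_oplus x 1; rewrite lneg1 rneg1 !oplusx0 lnegK. Qed.

Lemma lneg0 : lneg 0 = 1 :> M.
Proof. by rewrite -rneg1 rnegK. Qed.

Lemma odotE x y : x ⊙ y = rneg (lneg y ⊕ lneg x).
Proof. by []. Qed.

Lemma odotEl x y : x ⊙ y = lneg (rneg y ⊕ rneg x).
Proof. exact: neg_oplus. Qed.

Lemma lneg_oplus x y : lneg (x ⊕ y) = lneg y ⊙ lneg x.
Proof. by rewrite odotEl !lnegK. Qed.

Lemma rneg_oplus x y : rneg (x ⊕ y) = rneg y ⊙ rneg x.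
Proof. by rewrite odotE !rnegK. Qed.

Lemma lneg_odot x y : lneg (x ⊙ y) = lneg y ⊕ lneg x.
Proof. by rewrite odotE rnegK. Qed.

Lemma rneg_odot x y : rneg (x ⊙ y) = rneg y ⊕ rneg x.
Proof. by rewrite odotEl lnegK. Qed.

Lemma odotA x y z : x ⊙ (y ⊙ z) = x ⊙ y ⊙ z.
Proof. by rewrite !odotE !rnegK oplusA. Qed.

Lemma odotx1 x : x ⊙ 1 = x.
Proof. by rewrite odotE lneg1 oplus0x lnegK. Qed.

Lemma odot1x x : 1 ⊙ x = x.
Proof. by rewrite odotE lneg1 oplusx0 lnegK. Qed.

Lemma joinC x y : pmv_join x y = pmv_join y x.
Proof. exact: oplus_rneg_odotC. Qed.

Lemma joinEr x y : pmv_join x y = x ⊙ lneg y ⊕ y.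
Proof. by rewrite joinC; apply: oplus_rneg_odot_lneg. Qed.

Lemma oplusxV x : x ⊕ rneg x = 1.
Proof. by have := joinC x 1; rewrite /pmv_join odotx1 oplus1x. Qed.

Lemma oplusVx x : lneg x ⊕ x = 1.
Proof. by have := joinEr 1 x; rewrite odot1x /pmv_join oplus1x. Qed.

(** In the join [y ⊕ (rneg y ⊙ x)] the second summand is [rneg (lneg x ⊕ y)], which is 0 once
    [lneg x ⊕ y = 1]. *)
Lemma le_lneg_oplus x y : x ≤ y <-> lneg x ⊕ y = 1.
Proof.
split=> [<-|xy]; first by rewrite /pmv_join oplusA oplusVx oplus1x.
rewrite /pmv_le joinC /pmv_join.
by rewrite odotE rnegK xy rneg1 oplusx0.
Qed.

Lemma le_oplus_rneg x y : x ≤ y <-> y ⊕ rneg x = 1.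
Proof.
split=> [<-|xy]; first by rewrite joinC joinEr -oplusA oplusxV oplusx1.
by rewrite /pmv_le joinEr odotEl lnegK xy lneg1 oplus0x.
Qed.

Lemma le_addr x y : x ≤ x ⊕ y.
Proof. by apply/le_lneg_oplus; rewrite oplusA oplusVx oplus1x. Qed.

Lemma le_addl x y : x ≤ y ⊕ x.
Proof. by apply/le_oplus_rneg; rewrite -oplusA oplusxV oplusx1. Qed.

Lemma le_exists_addr x y : x ≤ y -> exists t, y = x ⊕ t.
Proof. by move=> <-; exists (rneg x ⊙ y). Qed.

Lemma le_exists_addl x y : x ≤ y -> exists t, y = t ⊕ x.
Proof. by move=> <-; rewrite joinC joinEr; eexists. Qed.

Lemma pmv_le_refl x : x ≤ x.
Proof. by apply/le_lneg_oplus; rewrite oplusVx. Qed.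

Lemma pmv_le_anti x y : x ≤ y -> y ≤ x -> x = y.
Proof. by move=> xy yx; rewrite -xy joinC. Qed.

Lemma pmv_le_trans y x z : x ≤ y -> y ≤ z -> x ≤ z.
Proof.
move=> /le_exists_addr[s ->] /le_exists_addr[t ->].
by rewrite -oplusA; apply: le_addr.
Qed.

Lemma pmv_le0x x : 0 ≤ x.
Proof. by rewrite -[x]oplus0x; apply: le_addr. Qed.

Lemma pmv_lex1 x : x ≤ 1.
Proof. by apply/le_lneg_oplus; rewrite oplusx1. Qed.

Lemma pmv_lex0 x : x ≤ 0 -> x = 0.
Proof. by move=> x0; apply: pmv_le_anti (pmv_le0x x). Qed.

Lemma oplus_le2r z x y : x ≤ y -> x ⊕ z ≤ y ⊕ z.
Proof. by move=> /le_exists_addl[t ->]; rewrite -oplusA; apply: le_addl. Qed.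

Lemma oplus_le2l z x y : x ≤ y -> z ⊕ x ≤ z ⊕ y.
Proof. by move=> /le_exists_addr[t ->]; rewrite oplusA; apply: le_addr. Qed.

Lemma lneg_anti x y : x ≤ y -> lneg y ≤ lneg x.
Proof. by move=> /le_lneg_oplus xy; apply/le_oplus_rneg; rewrite lnegK. Qed.

Lemma rneg_anti x y : x ≤ y -> rneg y ≤ rneg x.
Proof. by move=> /le_oplus_rneg xy; apply/le_lneg_oplus; rewrite rnegK. Qed.

Lemma odot_le2 x y z t : x ≤ y -> z ≤ t -> x ⊙ z ≤ y ⊙ t.
Proof.
move=> xy zt; rewrite !odotE; apply: rneg_anti.
apply: (@pmv_le_trans (lneg z ⊕ lneg y)).
  exact/oplus_le2r/lneg_anti.
exact/oplus_le2l/lneg_anti.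
Qed.

Lemma odot_lel x y : x ⊙ y ≤ x.
Proof. by rewrite -{2}[x]odotx1; apply: odot_le2 (pmv_le_refl x) (pmv_lex1 y). Qed.

(** Residuation: both sides unfold to [z ⊕ a ⊕ rneg x = 1]. *)
Lemma odot_lneg_le x a z : x ⊙ lneg a ≤ z <-> x ≤ z ⊕ a.
Proof.
by split=> /le_oplus_rneg H; apply/le_oplus_rneg; move: H;
  rewrite rneg_odot lnegK oplusA.
Qed.

Lemma pmv_join_lub x y z : x ≤ z -> y ≤ z -> pmv_join x y ≤ z.
Proof.
move=> xz yz; rewrite -[z]xz; apply: oplus_le2l.
exact: odot_le2 (pmv_le_refl _) yz.
Qed.

Definition pmv_meet x y : M := lneg (pmv_join (rneg x) (rneg y)).

Lemma meet_lel x y : pmv_meet x y ≤ x.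
Proof. by rewrite -{2}[x]rnegK; apply/lneg_anti/le_addr. Qed.

Lemma meetC x y : pmv_meet x y = pmv_meet y x.
Proof. by rewrite /pmv_meet joinC. Qed.

Lemma meet_ler x y : pmv_meet x y ≤ y.
Proof. by rewrite meetC; apply: meet_lel. Qed.

Lemma meet_glb x y z : z ≤ x -> z ≤ y -> z ≤ pmv_meet x y.
Proof.
move=> /rneg_anti zx /rneg_anti zy.
by rewrite -[z]rnegK; apply/lneg_anti/pmv_join_lub.
Qed.

Lemma meetx1 x : pmv_meet x 1 = x.
Proof.
apply: pmv_le_anti (meet_lel _ _) _.
exact: meet_glb (pmv_le_refl x) (pmv_lex1 x).
Qed.

(** By residuation, adding [a] on the right has a left adjoint, hence preserves meets. *)
Lemma oplus_meetl a x y : pmv_meet x y ⊕ a = pmv_meet (x ⊕ a) (y ⊕ a).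
Proof.
apply: pmv_le_anti.
  by apply: meet_glb; apply: oplus_le2r; [apply: meet_lel | apply: meet_ler].
apply/odot_lneg_le; apply: meet_glb; apply/odot_lneg_le.
  exact: meet_lel.
exact: meet_ler.
Qed.

(** * Boolean elements: centrality and complements *)

Section BooleanElement.
Variable a : M.
Hypothesis ha : boolean_elt a.

(** Since [a ⊕ a = a], the join absorbs a further [a], so it bounds [a ⊕ x]. Centrality of [a]
    follows from the symmetry of the join. *)
Lemma boolean_oplusE x : a ⊕ x = pmv_join a x.
Proof.
apply: pmv_le_anti.
  have ->: pmv_join a x = a ⊕ pmv_join a x by rewrite /pmv_join oplusA ha.
  by apply: oplus_le2l; rewrite joinC; apply: le_addr.
by apply: pmv_join_lub; [apply: le_addr | apply: le_addl].
Qed.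

Lemma boolean_oplusEr x : x ⊕ a = pmv_join x a.
Proof.
apply: pmv_le_anti.
  have ->: pmv_join x a = pmv_join x a ⊕ a by rewrite joinEr -oplusA ha.
  exact/oplus_le2r/le_addr.
by apply: pmv_join_lub; [apply: le_addr | apply: le_addl].
Qed.

Lemma boolean_central x : a ⊕ x = x ⊕ a.
Proof. by rewrite boolean_oplusE joinC boolean_oplusEr. Qed.

Lemma boolean_meet_lneg : pmv_meet (lneg a) a = 0.
Proof. by rewrite /pmv_meet lnegK -boolean_oplusE oplusxV lneg1. Qed.

Lemma boolean_lneg : boolean_elt (lneg a).
Proof.
rewrite /boolean_elt -[lneg a ⊕ lneg a]meetx1.
by rewrite -(oplusVx a) -boolean_central -oplus_meetl boolean_meet_lneg oplus0x.
Qed.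

Lemma boolean_odot_lneg x : lneg a ⊙ x = x ⊙ lneg a.
Proof. by rewrite !odotEl lnegK boolean_central. Qed.

End BooleanElement.

(** Recovers [x] from its images modulo [lneg a] and modulo [a]: the meet distributes, and [lneg a]
    and [a] meet in 0. *)
Lemma boolean_meet_oplus a x :
  boolean_elt a -> pmv_meet (x ⊕ lneg a) (x ⊕ a) = x.
Proof.
move=> ha; rewrite -(boolean_central (boolean_lneg ha)) -(boolean_central ha).
by rewrite -oplus_meetl boolean_meet_lneg // oplus0x.
Qed.

Lemma boolean_odot_idem a : a ⊙ a = a -> boolean_elt a.
Proof.
move=> aa; rewrite -[a]rnegK; apply: boolean_lneg.
by rewrite /boolean_elt -rneg_odot aa.
Qed.

(** * Square roots, their value at 0 and Boolean elements *)

Section SquareRoot.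
Variable r : M -> M.
Hypothesis hr : square_root r.

Lemma sqrt_mono x y : x ≤ y -> r x ≤ r y.
Proof. by move=> xy; apply: (sqrt_max hr); rewrite (sqrt_odot hr). Qed.

Lemma boolean_sqrt0_oplus : boolean_elt (r 0 ⊕ r 0).
Proof.
set c := r 0; set w := c ⊕ c.
have rw : r w ≤ w.
  (* Here [r w = c ⊕ rneg (r (lneg w))], so [lneg c ≤ r (lneg w)] suffices; it holds because
     [lneg c ⊙ lneg c = lneg w]. *)
  rewrite -[in r w](lnegK w) (sqrt_rneg hr) /rimpl; apply: oplus_le2l.
  rewrite -[X in _ ≤ X]lnegK; apply: rneg_anti; apply: (sqrt_max hr).
  by rewrite -lneg_oplus; apply: pmv_le_refl.
apply: boolean_odot_idem; apply: pmv_le_anti; first exact: odot_lel.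
by rewrite -{1}(sqrt_odot hr w); apply: odot_le2.
Qed.

(** If [r 0 = 0], then [r] commutes with [lneg], so [y = r x] satisfies both [y ⊙ y = x] and
    [y ⊕ y = x]. Hence [y ⊕ y ≤ y], and [x = y] is Boolean. *)
Lemma sqrt0_boolean : r 0 = 0 -> boolean_algebra M.
Proof.
move=> c0 x; rewrite -(rnegK x).
set y := lneg (r (rneg x)).
have yy : y ⊙ y = lneg (rneg x).
  by rewrite /y -[in RHS](sqrt_odot hr (lneg _)) (sqrt_lneg hr) c0 /limpl oplusx0.
have dy : y ⊕ y = lneg (rneg x) by rewrite -lneg_odot (sqrt_odot hr).
have yb : boolean_elt y.
  apply: pmv_le_anti (le_addr _ _).
  by rewrite dy -yy; apply: odot_lel.
by rewrite -dy yb.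
Qed.

Lemma sqrt0_strict : r 0 ⊕ r 0 = 1 -> strict_square_root r.
Proof.
move=> c1; split=> //; apply: pmv_le_anti; last first.
  by apply/le_oplus_rneg; rewrite lnegK.
by apply/le_lneg_oplus; rewrite -lneg_odot (sqrt_odot hr) lneg0.
Qed.

(** This is what lets [r] descend to the quotient by a Boolean element. *)
Lemma sqrt_boolean_oplus a x :
  boolean_elt a -> r (x ⊕ a) ⊕ a = r x ⊕ a.
Proof.
move=> ha; apply: pmv_le_anti; last first.
  by apply: oplus_le2r; apply: sqrt_mono; apply: le_addr.
have ->: r x ⊕ a = r x ⊕ a ⊕ a by rewrite -oplusA ha.
apply: oplus_le2r.
apply/odot_lneg_le; apply: (sqrt_max hr).
(* As [lneg a] is central and idempotent, [t ⊙ lneg a] has square [(x ⊕ a) ⊙ lneg a], which is below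
   [x]. *)
set t := r _; rewrite odotA -[t ⊙ _ ⊙ t]odotA (boolean_odot_lneg ha).
rewrite !odotA (sqrt_odot hr) -odotA -lneg_oplus ha.
by apply/odot_lneg_le; apply: pmv_le_refl.
Qed.

End SquareRoot.

Lemma strict_sqrt0_oplus (s : M -> M) : strict_square_root s -> s 0 ⊕ s 0 = 1.
Proof. by case=> _ s0; rewrite {1}s0 oplusVx. Qed.

Lemma boolean_odot x : boolean_algebra M -> x ⊙ x = x.
Proof. by move=> bM; rewrite odotE bM lnegK. Qed.

Lemma boolean_sqrt_id : boolean_algebra M -> square_root (fun x : M => x).
Proof.
move=> bM; split=> [x|x y|x|x].
- exact: boolean_odot.
- by rewrite boolean_odot.
- by rewrite /limpl oplusx0.
- by rewrite /rimpl oplus0x.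
Qed.

(** Being Boolean, [s 0] equals [s 0 ⊕ s 0 = 1]; strictness then gives [1 = lneg 1 = 0]. *)
Lemma boolean_strict_degenerate :
  boolean_algebra M -> strict_pmv M -> degenerate M.
Proof.
move=> bM [s sM]; have [_ s0] := sM.
have s1 : s 0 = 1 by rewrite -(bM (s 0)) strict_sqrt0_oplus.
by rewrite s1 lneg1 in s0.
Qed.

End Theory.

(** * Morphisms and their inverses *)

Section Morphism.
Variables (M N : pseudoMVType) (f : M -> N).
Hypothesis hf : pmv_morphism f.

Lemma morph_odot x y : f (x ⊙ y) = f x ⊙ f y.
Proof. by rewrite !odotE (morph_rneg hf) (morph_oplus hf) !(morph_lneg hf). Qed.

Lemma morph_le x y : x ≤ y -> f x ≤ f y.
Proof.
move=> /le_lneg_oplus xy; apply/le_lneg_oplus.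
by rewrite -(morph_lneg hf) -(morph_oplus hf) xy (morph_pmv1 hf).
Qed.

Lemma can_morphism (g : N -> M) : cancel f g -> cancel g f -> pmv_morphism g.
Proof.
move=> fK gK; have fI := can_inj fK.
split=> [x y|x|x||]; apply: fI; rewrite ?(morph_oplus hf) ?(morph_lneg hf)
  ?(morph_rneg hf) ?(morph_pmv0 hf) ?(morph_pmv1 hf) ?gK //.
Qed.

End Morphism.

(** The quotient of [M] by the ideal generated by a Boolean element [a],
    represented by the filter of the elements above [a]. *)
Definition boolean_quot (M : pseudoMVType) (a : M) (ha : boolean_elt a) :=
  {x : M | x ⊕ a = x}.

(** * Algebra structure and square root on the quotient by a Boolean element *)

Section BooleanQuotient.
Variables (M : pseudoMVType) (a : M).
Hypothesis ha : boolean_elt a.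
Local Notation Q := (boolean_quot ha).

Lemma oplus_booleanK (x : M) : x ⊕ a ⊕ a = x ⊕ a.
Proof. by rewrite -oplusA ha. Qed.

Definition quot_proj (x : M) : Q := exist _ (x ⊕ a) (oplus_booleanK x).

(** Equality on [M] need not be decidable, so the membership proofs are identified by proof
    irrelevance. *)
Lemma quot_inj (p q : Q) : sval p = sval q -> p = q.
Proof.
by case: p q => [x hx] [y hy] /= xy; subst y; rewrite (proof_irrelevance _ hx hy).
Qed.

Lemma quot_projK (p : Q) : quot_proj (sval p) = p.
Proof. by apply: quot_inj; case: p. Qed.

Definition quot_oplus (p q : Q) := quot_proj (sval p ⊕ sval q).
Definition quot_lneg (p : Q) := quot_proj (lneg (sval p)).
Definition quot_rneg (p : Q) := quot_proj (rneg (sval p)).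

(** With the next three identities, [quot_proj] respects all operations. As it is onto, each axiom
    of [Q] is the image of the same axiom of [M]. *)
Lemma quot_oplusE x y :
  quot_oplus (quot_proj x) (quot_proj y) = quot_proj (x ⊕ y).
Proof.
apply: quot_inj; rewrite /= -!oplusA (boolean_central ha) -!oplusA.
by rewrite !ha.
Qed.

Lemma quot_lnegE x : quot_lneg (quot_proj x) = quot_proj (lneg x).
Proof.
apply: quot_inj; rewrite /= -(boolean_central ha x) lneg_oplus.
by rewrite -joinEr boolean_oplusEr.
Qed.

Lemma quot_rnegE x : quot_rneg (quot_proj x) = quot_proj (rneg x).
Proof.
apply: quot_inj; rewrite /= rneg_oplus -!(boolean_central ha).
by rewrite (boolean_oplusE ha (rneg x)).
Qed.

Let odotQ := pmv_odot quot_oplus quot_lneg quot_rneg.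

Lemma quot_odotE x y : odotQ (quot_proj x) (quot_proj y) = quot_proj (x ⊙ y).
Proof. by rewrite /odotQ /pmv_odot !quot_lnegE quot_oplusE quot_rnegE. Qed.

Let quotE := (quot_odotE, quot_oplusE, quot_lnegE, quot_rnegE).
Let q0 := quot_proj 0.
Let q1 := quot_proj 1.

Fact quot_oplusA p q s :
  quot_oplus p (quot_oplus q s) = quot_oplus (quot_oplus p q) s.
Proof. by rewrite -[p]quot_projK -[q]quot_projK -[s]quot_projK !quotE oplusA. Qed.

Fact quot_oplusx0 p : quot_oplus p q0 = p.
Proof. by rewrite -[p]quot_projK quotE oplusx0. Qed.

Fact quot_oplus0x p : quot_oplus q0 p = p.
Proof. by rewrite -[p]quot_projK quotE oplus0x. Qed.

Fact quot_oplusx1 p : quot_oplus p q1 = q1.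
Proof. by rewrite -[p]quot_projK quotE oplusx1. Qed.

Fact quot_oplus1x p : quot_oplus q1 p = q1.
Proof. by rewrite -[p]quot_projK quotE oplus1x. Qed.

Fact quot_lneg1 : quot_lneg q1 = q0.
Proof. by rewrite quotE lneg1. Qed.

Fact quot_rneg1 : quot_rneg q1 = q0.
Proof. by rewrite quotE rneg1. Qed.

Fact quot_neg_oplus p q :
  quot_rneg (quot_oplus (quot_lneg p) (quot_lneg q))
  = quot_lneg (quot_oplus (quot_rneg p) (quot_rneg q)).
Proof. by rewrite -[p]quot_projK -[q]quot_projK !quotE neg_oplus. Qed.

Fact quot_oplus_rneg_odotC p q :
  quot_oplus p (odotQ (quot_rneg p) q) = quot_oplus q (odotQ (quot_rneg q) p).
Proof.
rewrite -[p]quot_projK -[q]quot_projK !quotE.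
by congr quot_proj; apply: oplus_rneg_odotC.
Qed.

Fact quot_oplus_rneg_odot_lneg p q :
  quot_oplus q (odotQ (quot_rneg q) p) = quot_oplus (odotQ p (quot_lneg q)) q.
Proof.
rewrite -[p]quot_projK -[q]quot_projK !quotE.
by congr quot_proj; apply: oplus_rneg_odot_lneg.
Qed.

Fact quot_odot_lneg_oplusC p q :
  quot_oplus (odotQ p (quot_lneg q)) q = quot_oplus (odotQ q (quot_lneg p)) p.
Proof.
rewrite -[p]quot_projK -[q]quot_projK !quotE.
by congr quot_proj; apply: odot_lneg_oplusC.
Qed.

Fact quot_odot_lneg_oplus p q :
  odotQ p (quot_oplus (quot_lneg p) q) = odotQ (quot_oplus p (quot_rneg q)) q.
Proof.
rewrite -[p]quot_projK -[q]quot_projK !quotE.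
by congr quot_proj; apply: odot_lneg_oplus.
Qed.

Fact quot_lnegK p : quot_rneg (quot_lneg p) = p.
Proof. by rewrite -[p]quot_projK !quotE lnegK. Qed.

HB.instance Definition _ := isPseudoMV.Build Q
  quot_oplusA quot_oplusx0 quot_oplus0x quot_oplusx1 quot_oplus1x
  quot_lneg1 quot_rneg1 quot_neg_oplus quot_oplus_rneg_odotC
  quot_oplus_rneg_odot_lneg quot_odot_lneg_oplusC quot_odot_lneg_oplus
  quot_lnegK.

Lemma quot_proj_morphism : pmv_morphism (quot_proj : M -> Q).
Proof.
split=> // [x y|x|x].
- by rewrite -quot_oplusE.
- by rewrite -quot_lnegE.
- by rewrite -quot_rnegE.
Qed.

Definition quot_sqrt (r : M -> M) (p : Q) : Q := quot_proj (r (sval p)).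

Lemma quot_sqrtE r x :
  square_root r -> quot_sqrt r (quot_proj x) = quot_proj (r x).
Proof. by move=> hr; apply: quot_inj; rewrite /= sqrt_boolean_oplus. Qed.

Lemma quot_le_sval (p q : Q) : p ≤ q -> sval p ≤ sval q.
Proof.
by move=> /le_exists_addr[t ->]; rewrite /= -oplusA; apply: le_addr.
Qed.

Lemma quot_square_root r : square_root r -> square_root (quot_sqrt r).
Proof.
move=> hr; have hp := quot_proj_morphism.
split=> [p|p q qp|p|p].
- by rewrite -(morph_odot hp) (sqrt_odot hr) quot_projK.
- rewrite -[q]quot_projK; apply: (morph_le hp); apply: (sqrt_max hr).
  (* The representative of [q ⊙ q] is [sval q ⊙ sval q ⊕ a], hence above [sval q ⊙ sval q]. *)
  apply: pmv_le_trans (quot_le_sval qp).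
  by rewrite -[q]quot_projK -(morph_odot hp) /= (_ : sval q ⊕ a = sval q);
    [apply: le_addr | case: (q)].
- rewrite -[p]quot_projK -(morph_lneg hp) -(morph_pmv0 hp) !quot_sqrtE //.
  by rewrite (sqrt_lneg hr) (morph_oplus hp) (morph_lneg hp).
- rewrite -[p]quot_projK -(morph_rneg hp) -(morph_pmv0 hp) !quot_sqrtE //.
  by rewrite (sqrt_rneg hr) (morph_oplus hp) (morph_rneg hp).
Qed.

End BooleanQuotient.

(** * Decomposition of an algebra along a Boolean element *)

Lemma boolean_quot_decomposition (M : pseudoMVType) (a : M)
    (ha : boolean_elt a) (hb : boolean_elt (lneg a)) :
  pmv_isomorphic M (boolean_quot ha * boolean_quot hb)%type.
Proof.
have [pD pL pR p0 p1] := quot_proj_morphism ha.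
have [qD qL qR q0 q1] := quot_proj_morphism hb.
exists (fun x => (quot_proj ha x, quot_proj hb x)); split.
  split=> [x y|x|x||]; rewrite ?pD ?pL ?pR ?p0 ?p1 ?qD ?qL ?qR ?q0 ?q1 //.
exists (fun u => pmv_meet (sval u.2) (sval u.1)) => [x|[p q]] /=.
  exact: boolean_meet_oplus.
have pa : sval p ⊕ a = sval p by case: (p).
have qb : sval q ⊕ lneg a = sval q by case: (q).
(* Each representative becomes 1 in the other quotient, so it drops out of the projected meet. *)
have q1a : sval q ⊕ a = 1 by rewrite -qb -oplusA oplusVx oplusx1.
have p1b : sval p ⊕ lneg a = 1.
  by rewrite -pa -oplusA (boolean_central ha) oplusVx oplusx1.
congr pair; apply: quot_inj; rewrite /= oplus_meetl.
  by rewrite pa q1a meetC meetx1.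
by rewrite qb p1b meetx1.
Qed.

(** * Square roots under isomorphisms and products *)

Lemma comp_morphism (M N P : pseudoMVType) (f : M -> N) (g : N -> P) :
  pmv_morphism f -> pmv_morphism g -> pmv_morphism (g \o f).
Proof.
move=> [fD fL fR f0 f1] [gD gL gR g0 g1].
by split=> [x y|x|x||] /=; rewrite ?fD ?fL ?fR ?f0 ?f1.
Qed.

(** Both [f (r 0)] and the preimage of [s 0] square to 0, so [sqrt_max] gives the two
    inequalities. *)
Lemma iso_sqrt0 (M N : pseudoMVType) (f : M -> N) (r : M -> M) (s : N -> N) :
  pmv_morphism f -> bijective f -> square_root r -> square_root s ->
  f (r 0) = s 0.
Proof.
move=> hf [g fK gK] hr hs; have hg := can_morphism hf fK gK.
apply: pmv_le_anti.
  apply: (sqrt_max hs); rewrite -(morph_odot hf) (sqrt_odot hr) (morph_pmv0 hf).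
  exact: pmv_le_refl.
rewrite -[s 0]gK; apply: (morph_le hf); apply: (sqrt_max hr).
rewrite -(morph_odot hg) (sqrt_odot hs) (morph_pmv0 hg).
exact: pmv_le_refl.
Qed.

Lemma prod_square_root (M N : pseudoMVType) (r : M -> M) (s : N -> N) :
  square_root r -> square_root s ->
  square_root (fun u : (M * N)%type => (r u.1, s u.2)).
Proof.
move=> hr hs; split=> [[x y]|[x y] [z t] [zx ty]|[x y]|[x y]].
- by congr pair; [apply: sqrt_odot hr x | apply: sqrt_odot hs y].
- by congr pair; [apply: (sqrt_max hr) | apply: (sqrt_max hs)].
- by congr pair; [apply: sqrt_lneg hr x | apply: sqrt_lneg hs y].
- by congr pair; [apply: sqrt_rneg hr x | apply: sqrt_rneg hs y].
Qed.

(** The identity on [A] and a strict root [s] on [B] give a product root with value [(0, s 0)] at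
    0. *)
Lemma iso_sqrt0_oplus (M A B : pseudoMVType) (f : M -> (A * B)%type)
    (r : M -> M) :
  pmv_morphism f -> bijective f -> square_root r ->
  boolean_algebra A -> strict_pmv B -> f (r 0 ⊕ r 0) = (0, 1).
Proof.
move=> hf bf hr bA [s sB]; have [hs _] := sB.
rewrite (morph_oplus hf).
rewrite (iso_sqrt0 hf bf hr (prod_square_root (boolean_sqrt_id bA) hs)).
by congr pair; [apply: oplusx0 | apply: strict_sqrt0_oplus].
Qed.

(** * Factors of a product isomorphism that fixes [(0, 1)] *)

Section FirstFactor.
Variables (A B C D : pseudoMVType) (h : (A * B)%type -> (C * D)%type).
Hypothesis hh : pmv_morphism h.
Hypothesis h01 : h (0, 1) = (0, 1).

(** Adding [(0, 1)] turns the second coordinate into 1 in the source and leaves the first coordinate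
    of the image unchanged. *)
Lemma prod_fst_indep (x : A) (y z : B) : (h (x, y)).1 = (h (x, z)).1.
Proof.
have fst1 t : (h (x, t)).1 = (h (x, 1)).1.
  have -> : (x, 1) = (x, t) ⊕ (0, 1) :> (A * B)%type.
    by congr pair; rewrite /= ?oplusx0 ?oplusx1.
  by rewrite (morph_oplus hh) h01 /= [RHS]oplusx0.
by rewrite !fst1.
Qed.

Lemma prod_fst_morphism : pmv_morphism (fun x : A => (h (x, 0)).1).
Proof.
split=> [x y|x|x||].
- have -> : (x ⊕ y, 0) = (x, 0) ⊕ (y, 0) :> (A * B)%type.
    by congr pair; rewrite /= oplusx0.
  by rewrite (morph_oplus hh).
- rewrite (prod_fst_indep _ 0 (lneg 0)).
  by rewrite -[(lneg x, _)]/(lneg ((x, 0) : (A * B)%type)) (morph_lneg hh).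
- rewrite (prod_fst_indep _ 0 (rneg 0)).
  by rewrite -[(rneg x, _)]/(rneg ((x, 0) : (A * B)%type)) (morph_rneg hh).
- by rewrite -[(0, 0)]/(0 : (A * B)%type) (morph_pmv0 hh).
- rewrite (prod_fst_indep _ 0 1).
  by rewrite -[(1, 1)]/(1 : (A * B)%type) (morph_pmv1 hh).
Qed.

End FirstFactor.

Lemma prod_fst_isomorphic (A B C D : pseudoMVType)
    (h : (A * B)%type -> (C * D)%type) :
  pmv_morphism h -> bijective h -> h (0, 1) = (0, 1) -> pmv_isomorphic A C.
Proof.
move=> hh [k hK kK] h01; have hk := can_morphism hh hK kK.
have k01 : k (0, 1) = (0, 1) by rewrite -h01 hK.
exists (fun x => (h (x, 0)).1); split; first exact: prod_fst_morphism.
exists (fun x => (k (x, 0)).1) => x.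
  (* The 0 is traded for the actual second coordinate of [h (x, 0)], so that [k] cancels [h]. *)
  rewrite (prod_fst_indep hk k01 _ 0 (h (x, 0)).2) -surjective_pairing.
  by rewrite hK.
rewrite (prod_fst_indep hh h01 _ 0 (k (x, 0)).2) -surjective_pairing.
by rewrite kK.
Qed.

Definition pmv_swap (A B : pseudoMVType) (u : (A * B)%type) : (B * A)%type :=
  (u.2, u.1).

Lemma swap_morphism (A B : pseudoMVType) : pmv_morphism (@pmv_swap A B).
Proof. by split. Qed.

Lemma swap_bij (A B : pseudoMVType) : bijective (@pmv_swap A B).
Proof. by exists (@pmv_swap B A); case. Qed.

(** Conjugating by the swap reduces this to first factors, since [h] also fixes
    [(1, 0) = lneg (0, 1)]. *)
Lemma prod_snd_isomorphic (A B C D : pseudoMVType)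
    (h : (A * B)%type -> (C * D)%type) :
  pmv_morphism h -> bijective h -> h (0, 1) = (0, 1) -> pmv_isomorphic B D.
Proof.
move=> hh bh h01.
have h10 : h (1, 0) = (1, 0).
  have -> : (1, 0) = lneg (0, 1) :> (A * B)%type.
    by congr pair; rewrite /= ?lneg0 ?lneg1.
  by rewrite (morph_lneg hh) h01; congr pair; rewrite /= ?lneg0 ?lneg1.
apply: (@prod_fst_isomorphic _ A _ C (@pmv_swap C D \o h \o @pmv_swap B A)).
- apply: comp_morphism (swap_morphism B A) _.
  exact: comp_morphism hh (swap_morphism C D).
- by apply: bij_comp (swap_bij B A); apply: bij_comp (swap_bij C D) bh.
- by rewrite /= /pmv_swap h10.
Qed.

Theorem theorem4p3 (M : pseudoMVType) (hM : 0 <> 1 :> M)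
    (r : M -> M) (hr : square_root r) :
  exactly_one
    (boolean_algebra M)
    (strict_pmv M)
    (exists M1 M2 : pseudoMVType, boolean_strict_decomposition M M1 M2)
  /\ (forall M1 M2 N1 N2 : pseudoMVType,
        boolean_strict_decomposition M M1 M2 ->
        boolean_strict_decomposition M N1 N2 ->
        pmv_isomorphic M1 N1 /\ pmv_isomorphic M2 N2).
Proof.
split; last first.
  move=> M1 M2 N1 N2 [bM1 sM2 _ _ [f [hf bf]]] [bN1 sN2 _ _ [g [hg bg]]].
  have [f' fK f'K] := bf.
  have hf' := can_morphism hf fK f'K.
  have hgf := comp_morphism hf' hg.
  have bgf : bijective (g \o f') by apply: bij_comp bg _; exists f.
  (* Both decompositions send [r 0 ⊕ r 0] to [(0, 1)]. *)
  have gf01 : (g \o f') (0, 1) = (0, 1).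
    rewrite -(iso_sqrt0_oplus hf bf hr bM1 sM2) /= fK.
    exact: iso_sqrt0_oplus hg bg hr bN1 sN2.
  split; first exact: prod_fst_isomorphic hgf bgf gf01.
  exact: prod_snd_isomorphic hgf bgf gf01.
split; last split.
- have wb := boolean_sqrt0_oplus hr; set w := r 0 ⊕ r 0 in wb.
  (* The cases [w = 0], [w = 1] and neither give (i), (ii) and (iii). *)
  have [w0|w0] := classic (w = 0).
    left; apply: (sqrt0_boolean hr); apply: pmv_lex0.
    by have := le_addr (r 0) (r 0); rewrite -/w w0.
  have [w1|w1] := classic (w = 1).
    by right; left; exists r; apply: sqrt0_strict.
  have vb := boolean_lneg wb.
  right; right; exists (boolean_quot wb), (boolean_quot vb); split.
  + apply: (sqrt0_boolean (quot_square_root wb hr)).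
    rewrite -(morph_pmv0 (quot_proj_morphism wb)) quot_sqrtE //.
    (* Modulo [w] the root of 0 is the class of [r 0], which is 0 because [r 0 ≤ w]. *)
    by apply: quot_inj; rewrite /= oplus0x boolean_oplusEr //; apply: le_addr.
  + exists (quot_sqrt (ha:=vb) r).
    apply: sqrt0_strict; first exact: quot_square_root.
    have hp := quot_proj_morphism vb.
    rewrite -(morph_pmv0 hp) quot_sqrtE // -(morph_oplus hp).
    apply: quot_inj; rewrite /= oplus1x.
    by rewrite -(boolean_central vb) oplusVx.
  + move=> /(congr1 sval) /=; rewrite oplus0x oplus1x; exact: w1.
  + move=> /(congr1 sval) /=; rewrite oplus0x oplus1x => v1.
    by apply: w0; rewrite -[w]lnegK v1 rneg1.
  + exact: boolean_quot_decomposition.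
- by case=> bM sM; apply: hM; apply: boolean_strict_degenerate.
(* The factor [M2], an image of the Boolean algebra [M], would be both Boolean and strict. *)
- case=> bM [M1 [M2 [_ sM2 _ ndeg [f [hf [g fK gK]]]]]].
  apply: ndeg; apply: boolean_strict_degenerate sM2 => x.
  have := congr1 (fun y => (f y).2) (bM (g (0, x))).
  by rewrite /= (morph_oplus hf) gK.
(* Strictness of [M] gives [s 0 ⊕ s 0 = 1], so [f] would send 1 to both [(0, 1)] and [(1, 1)]. *)
- case=> [[s sM] [M1 [M2 [bM1 sM2 ndeg _ [f [hf bf]]]]]].
  apply: ndeg; have [hs _] := sM.
  have := iso_sqrt0_oplus hf bf hs bM1 sM2.
  rewrite (strict_sqrt0_oplus sM) (morph_pmv1 hf).
  by move=> /(congr1 fst) /= /esym.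
Qed.
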